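(* Let $B$ be a topological space and consider fibrewise maps $f,g:X\to Y$ and $f',g':X'\to Y'$ between fibrewise spaces over $B$. If the space $X\times_B X'$ is normal, then $$D_B(f\times_B f',g\times_B g')\le D_B(f,g)+D_B(f',g').$$
   Context: Fix a topological space $B$ and let $I=[0,1]$. A fibrewise space over $B$ is a topological space $X$ with a continuous map $p_X:X\to B$; a fibrewise map $f:X\to Y$ is a continuous map with $p_Y\circ f=p_X$. A subspace $U\subset X$ is a fibrewise space via $p_X|_U$. Two fibrewise maps $f,g:X\to Y$ are fibrewise homotopic, $f\simeq_B g$, if there is a continuous $H:X\times I\to Y$ with $H(x,0)=f(x)$, $H(x,1)=g(x)$ and $p_Y(H(x,t))=p_X(x)$ for all $x,t$. The fibrewise product is $X\times_B X'=\{(x,x')\in X\times X': p_X(x)=p_{X'}(x')\}$, a fibrewise space over $B$ in the obvious way, and $f\times_B f':X\times_B X'\to Y\times_B Y'$ is $(x,x')\mapsto(f(x),f'(x'))$. Parametrized homotopic distance: for fibrewise maps $f,g:X\to Y$, $D_B(f,g)$ is the smallest integer $n\ge 0$ such that $X$ has an open cover $\{U_0,\dots,U_n\}$ with $f|_{U_i}\simeq_B g|_{U_i}$ for all $i$; it is $\infty$ if no such $n$ exists. *)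

(* Defs.v *)
From HB Require Import structures.
From mathcomp Require Import all_boot all_order all_algebra.
From mathcomp Require Import all_classical all_reals all_analysis.

Set Implicit Arguments.
Unset Strict Implicit.
Unset Printing Implicit Defensive.

Import Order.TTheory GRing.Theory Num.Theory.
Import numFieldNormedType.Exports.

Local Open Scope classical_set_scope.
Local Open Scope ring_scope.

Record fibSpace (B : topologicalType) := FibSpace {
  fib_carrier :> topologicalType;
  fib_proj : fib_carrier -> B;
  fib_proj_continuous : continuous fib_proj
}.

Record fibMap (B : topologicalType) (X Y : fibSpace B) := FibMap {
  fib_fun :> X -> Y;
  fib_fun_continuous : continuous fib_fun;
  fib_fun_proj : forall x, fib_proj (fib_fun x) = fib_proj x
}.

(* [set_type U] carries the subspace topology (initial for [set_val]). *)
Section FibSubspace.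
Context (B : topologicalType) (X : fibSpace B) (U : set X).

Lemma fib_sub_proj_continuous :
  continuous (fun x : set_type U => fib_proj (set_val x)).
Proof.
move=> x; apply: continuous_comp; first exact: initial_continuous.
exact: fib_proj_continuous.
Qed.

Definition fib_sub : fibSpace B := FibSpace fib_sub_proj_continuous.

Context (Y : fibSpace B) (f : fibMap X Y).

Lemma fib_restr_continuous : continuous (fun x : fib_sub => f (set_val x)).
Proof.
move=> x; apply: continuous_comp; first exact: initial_continuous.
exact: fib_fun_continuous.
Qed.

Lemma fib_restr_proj (x : fib_sub) : fib_proj (f (set_val x)) = fib_proj x.
Proof. exact: fib_fun_proj. Qed.

Definition fib_restr : fibMap fib_sub Y :=
  FibMap fib_restr_continuous fib_restr_proj.

End FibSubspace.

Section FibProduct.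
Context (B : topologicalType).

Definition fib_prod_set (X X' : fibSpace B) : set (X * X')%type :=
  [set z | fib_proj z.1 = fib_proj z.2].
Arguments fib_prod_set : clear implicits.

Lemma fib_prod_proj_continuous (X X' : fibSpace B) :
  continuous (fun z : set_type (fib_prod_set X X') => fib_proj (set_val z).1).
Proof.
move=> z; apply: (@continuous_comp _ _ _ (fun z => (set_val z).1)).
  apply: continuous_comp; first exact: initial_continuous.
  exact: cvg_fst.
exact: fib_proj_continuous.
Qed.

Definition fib_prod (X X' : fibSpace B) : fibSpace B :=
  FibSpace (@fib_prod_proj_continuous X X').

Context (X X' Y Y' : fibSpace B) (f : fibMap X Y) (f' : fibMap X' Y').

Lemma fib_prod_fun_subproof (z : fib_prod X X') :
  (f (set_val z).1, f' (set_val z).2) \in fib_prod_set Y Y'.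
Proof.
by apply/mem_set; rewrite /fib_prod_set /= !fib_fun_proj; apply: (set_valP z).
Qed.

Definition fib_prod_fun (z : fib_prod X X') : fib_prod Y Y' :=
  exist _ (f (set_val z).1, f' (set_val z).2) (fib_prod_fun_subproof z).

Lemma fib_prod_fun_continuous : continuous fib_prod_fun.
Proof.
apply: (@continuous_comp_initial (set_type (fib_prod_set Y Y'))
  (fib_prod X X') (Y * Y')%type set_val fib_prod_fun).
have cval : continuous (set_val : fib_prod X X' -> _).
  exact: initial_continuous.
have c1 : continuous (fun z : fib_prod X X' => f (set_val z).1).
  move=> z; apply: (@continuous_comp _ _ _
      (fun z : fib_prod X X' => (set_val z).1) f).
    by apply: continuous_comp; [exact: cval|exact: cvg_fst].
  exact: fib_fun_continuous.
have c2 : continuous (fun z : fib_prod X X' => f' (set_val z).2).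
  move=> z; apply: (@continuous_comp _ _ _
      (fun z : fib_prod X X' => (set_val z).2) f').
    by apply: continuous_comp; [exact: cval|exact: cvg_snd].
  exact: fib_fun_continuous.
by move=> z; exact: (cvg_pair (c1 z) (c2 z)).
Qed.

Lemma fib_prod_fun_proj (z : fib_prod X X') :
  fib_proj (fib_prod_fun z) = fib_proj z.
Proof. exact: fib_fun_proj. Qed.

Definition fib_prod_map : fibMap (fib_prod X X') (fib_prod Y Y') :=
  FibMap fib_prod_fun_continuous fib_prod_fun_proj.

End FibProduct.

Section UnitInterval.
Context (R : realType).

Definition unit_itv : topologicalType := set_type `[(0 : R), 1].

Lemma unit_itv0_subproof : (0 : R) \in `[(0 : R), 1]%classic.
Proof. by apply/mem_set; rewrite /= in_itv /= lexx ler01. Qed.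

Lemma unit_itv1_subproof : (1 : R) \in `[(0 : R), 1]%classic.
Proof. by apply/mem_set; rewrite /= in_itv /= lexx ler01. Qed.

Definition unit_itv0 : unit_itv := exist _ 0 unit_itv0_subproof.
Definition unit_itv1 : unit_itv := exist _ 1 unit_itv1_subproof.

End UnitInterval.

Definition fib_homotopic (R : realType) (B : topologicalType)
    (X Y : fibSpace B) (f g : fibMap X Y) : Prop :=
  exists H : (X * unit_itv R)%type -> Y,
    [/\ continuous H,
        forall x, H (x, unit_itv0 R) = f x,
        forall x, H (x, unit_itv1 R) = g x
      & forall x t, fib_proj (H (x, t)) = fib_proj x].

Definition has_fib_cover (R : realType) (B : topologicalType)
    (X Y : fibSpace B) (f g : fibMap X Y) (n : nat) : Prop :=
  exists U : 'I_n.+1 -> set X,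
    [/\ forall i, open (U i),
        \bigcup_i U i = [set: X]
      & forall i, fib_homotopic R (fib_restr (U i) f) (fib_restr (U i) g)].

Lemma has_fib_cover_asbool (R : realType) (B : topologicalType)
    (X Y : fibSpace B) (f g : fibMap X Y) :
  (exists n, has_fib_cover R f g n) -> exists n, `[< has_fib_cover R f g n >].
Proof. by case=> n hn; exists n; apply/asboolP. Qed.

(* Values in the naturals extended by [+oo], embedded in [\bar R]. *)
Definition fib_dist (R : realType) (B : topologicalType)
    (X Y : fibSpace B) (f g : fibMap X Y) : \bar R :=
  match pselect (exists n, has_fib_cover R f g n) with
  | left h => ((ex_minn (has_fib_cover_asbool h))%:R)%:E
  | right _ => +oo%E
  end.

(* Main.v *)
Require Import Defs.
From HB Require Import structures.
From mathcomp Require Import all_boot all_order all_algebra.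
From mathcomp Require Import all_classical all_reals all_analysis.

Set Implicit Arguments.
Unset Strict Implicit.
Unset Printing Implicit Defensive.

Import Order.TTheory GRing.Theory Num.Theory.
Import numFieldNormedType.Exports.

Local Open Scope classical_set_scope.
Local Open Scope ring_scope.

(** A fibrewise homotopy over a set of pairs can be built one coordinate at a
time, so on the fibrewise product [W] a set contained in both the preimage of
some [U i] and the preimage of some [V j] is good, where [U] and [V] are covers
of [X] and [X'] that realize the two distances [n] and [m], assumed finite. The
naive cover by all these intersections has [(n + 1) * (m + 1)] members. Good
open sets that are pairwise disjoint can be merged into a single one, because
their homotopies glue without any compatibility condition
([homotopic_on_bigcup]). It remains to refine the two pulled-back covers by a
family of open sets that splits into [n + m + 1] classes of pairwise disjoint
members ([normal_common_refinement]).

This is where normality enters. Urysohn functions turn the two covers into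
[n + m + 2] continuous functions [chi a], each positive only inside the
corresponding member of its cover, such that at every point some function of
each cover exceeds [1/2]. For a set [Q] of indices let [dominance chi Q]
consist of the points at which the functions indexed by [Q] are positive and
larger than all the others. These sets are open; those of two different [Q]
with the same number of indices are disjoint, since a point in both would rank
some index both above and below another one. If [Q] contains indices of both
covers, then [dominance chi Q] is good, and every point is in such a set: take
for [Q] the indices whose function exceeds [1/2] there. Such [Q] have between
[2] and [n + m + 2] elements, and these [n + m + 1] cardinalities are the
classes. *)

(** * Urysohn functions subordinate to a finite open cover *)

(** Requiring a value above [1/2], an open condition, is what lets the members
of the cover be replaced one after the other: the superlevel set that replaces
[U a] is again an open set, so the next step starts from an open cover. *)
Lemma normal_cover_bumps (R : realType) (T : topologicalType) (I : finType)
    (U : I -> set T) :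
  normal_space T -> (forall i, open (U i)) -> (forall x, exists i, U i x) ->
  exists phi : I -> T -> R,
    [/\ forall i, continuous (phi i),
        forall i x, 0 < phi i x -> U i x
      & forall x, exists i, 2^-1 < phi i x].
Proof.
move=> nT oU covU.
have half0 : (0 : R) < 2^-1 by rewrite invr_gt0.
suff H (s : seq I) : exists phi : I -> T -> R,
    [/\ forall i, continuous (phi i),
        forall i x, 0 < phi i x -> U i x
      & forall x, exists i, if i \in s then (2^-1 < phi i x : Prop) else U i x].
  have [phi [cphi phiU covphi]] := H (enum I).
  exists phi; split => // x.
  by have [i] := covphi x; rewrite mem_enum; exists i.
elim: s => [|a s [phi [cphi phiU covphi]]].
  exists (fun _ _ => 0); split => [i|i x|x].
  - exact: cst_continuous.
  - by rewrite ltxx.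
  - by have [i Ui] := covU x; exists i.
pose G i := [set x | if i \in s then (2^-1 < phi i x : Prop) else U i x].
have oG i : open (G i).
  rewrite /G; case: (i \in s); last exact: oU.
  rewrite (_ : [set x | _] = phi i @^-1` [set y | 2^-1 < y]) //.
  by apply: open_comp => [x _|]; [exact: cphi|exact: open_gt].
(* The points that only [U a] covers at this stage, where the new function
   has to be large. *)
pose F := ~` \bigcup_(i in [set i | i != a]) G i.
have FU : F `<=` U a.
  move=> x Fx; have [i Gi] := covphi x.
  have ia : i = a by apply: contrapT => /eqP ia; apply: Fx; exists i.
  move: Gi; rewrite ia; case: ifP => // _ /(lt_trans half0); exact: phiU.
have cF : closed F by apply: open_closedC; apply: bigcup_open => i _; exact: oG.
have [psi [cpsi psi01 psi0 psi1]] : exists psi : T -> R,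
    [/\ continuous psi, range psi `<=` `[0, 1],
        psi @` (~` U a) `<=` [set 0] & psi @` F `<=` [set 1]].
  apply/uniform_separatorP; apply: (proj1 (@normal_separatorP R T) nT) => //.
  - exact: open_closedC.
  - by apply/disjoints_subset => x nUx /FU.
exists (fun i => if i == a then psi else phi i); split => [i|i x|x].
- by case: ifP.
- case: eqP => [->|_]; last exact: phiU.
  move=> psi_gt0; apply: contrapT => nU.
  by move: psi_gt0; rewrite (psi0 (psi x)) ?ltxx//; exists x.
- have [[i /= ia Gi]|Fx] := EM ((\bigcup_(i in [set i | i != a]) G i) x).
    by exists i; rewrite inE (negbTE ia); exact: Gi.
  exists a; rewrite mem_head eqxx (psi1 (psi x)); last by exists x.
  by rewrite invf_lt1 // ltr1n.
Qed.

(** * Disjoint open sets from dominance among functions *)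

Definition dominance (R : realType) (T : topologicalType) (A : finType)
    (chi : A -> T -> R) (Q : {set A}) : set T :=
  [set x | forall a, a \in Q ->
    0 < chi a x /\ forall b, b \notin Q -> chi b x < chi a x].

Lemma open_dominance (R : realType) (T : topologicalType) (A : finType)
    (chi : A -> T -> R) (Q : {set A}) :
  (forall a, continuous (chi a)) -> open (dominance chi Q).
Proof.
move=> cchi; rewrite openE => x Qx.
apply: filter_forall => a.
have [aQ|aQ] := boolP (a \in Q); last by apply: nearW => y.
have [a0 ab] := Qx a aQ.
have near_gt0 : \forall y \near x, 0 < chi a y by apply: (cvgr_gt _ (cchi a x)).
have near_gt : \forall y \near x, forall b, b \notin Q -> chi b y < chi a y.
  apply: filter_forall => b.
  have [bQ|bQ] := boolP (b \in Q); first by apply: nearW => y.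
  have : \forall y \near x, 0 < chi a y - chi b y.
    apply: (cvgr_gt (chi a x - chi b x)); last by rewrite subr_gt0 ab.
    by apply: cvgB; exact: cchi.
  by apply: filterS => y; rewrite subr_gt0.
by apply: filterS2 near_gt0 near_gt => y.
Qed.

(** If [Q] and [Q'] differ but have as many elements, each contains an index
that the other lacks, and a common point would order their values both ways. *)
Lemma dominance_inj (R : realType) (T : topologicalType) (A : finType)
    (chi : A -> T -> R) (Q Q' : {set A}) x :
  #|Q| = #|Q'| -> dominance chi Q x -> dominance chi Q' x -> Q = Q'.
Proof.
move=> cQ Qx Q'x; apply: contrapT => /eqP nQ.
have := nQ; rewrite eqEcard cQ leqnn andbT => /subsetPn[a aQ aQ'].
have := nQ; rewrite eq_sym eqEcard cQ leqnn andbT => /subsetPn[b bQ' bQ].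
have := (Qx a aQ).2 b bQ.
by rewrite ltNge ltW //; exact: (Q'x b bQ').2.
Qed.

(** The members are the dominance sets of the Urysohn functions of both covers,
classified by the number of dominating indices: the class [c q] is this number,
which ranges from [2] to [n + m + 2], minus [2]. *)
Lemma normal_common_refinement (R : realType) (T : topologicalType)
    (n m : nat) (U : 'I_n.+1 -> set T) (V : 'I_m.+1 -> set T) :
  normal_space T ->
  (forall i, open (U i)) -> (forall x, exists i, U i x) ->
  (forall j, open (V j)) -> (forall x, exists j, V j x) ->
  exists (K : finType) (c : K -> 'I_(n + m).+1) (W : K -> set T),
    [/\ forall q, open (W q),
        forall x, exists q, W q x,
        forall q q' x, c q = c q' -> W q x -> W q' x -> q = q'
      & forall q, exists i j, W q `<=` U i `&` V j].
Proof.
move=> nT oU covU oV covV.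
have [phi [cphi phiU covphi]] := normal_cover_bumps R nT oU covU.
have [psi [cpsi psiV covpsi]] := normal_cover_bumps R nT oV covV.
pose chi (a : 'I_n.+1 + 'I_m.+1) :=
  match a with inl i => phi i | inr j => psi j end.
have cchi a : continuous (chi a) by case: a.
(* Only these [Q] force a point into members of both covers, and excluding the
   others removes the cardinalities [0] and [1]. *)
pose mixed (Q : {set 'I_n.+1 + 'I_m.+1}) :=
  [exists i, inl i \in Q] && [exists j, inr j \in Q].
have card_mixed Q : mixed Q -> (1 < #|Q| <= (n + m).+2)%N.
  move=> /andP[/existsP[i iQ] /existsP[j jQ]]; apply/andP; split.
    by rewrite (cardD1 (inl i)) iQ (cardD1 (inr j)) !inE jQ.
  by rewrite (leq_trans (max_card _)) // card_sum !card_ord addSn addnS.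
exists {Q | mixed Q},
  (fun q : {Q | mixed Q} => inord (#|val q| - 2) : 'I_(n + m).+1),
  (fun q : {Q | mixed Q} => dominance chi (val q)); split => [q|x|q q' x eqc|q].
- exact: open_dominance.
- pose Q := [set a | 2^-1 < chi a x]%SET.
  have mQ : mixed Q.
    have [i xi] := covphi x; have [j xj] := covpsi x.
    by apply/andP; split; apply/existsP; [exists i|exists j]; rewrite inE.
  exists (exist _ Q mQ) => a /=; rewrite inE => xa; split.
    by apply: le_lt_trans xa; rewrite invr_ge0.
  by move=> b; rewrite inE -leNgt => /le_lt_trans; apply.
- move=> Wq Wq'; apply: val_inj; apply: dominance_inj Wq Wq'.
  have /andP[q1 q2] := card_mixed _ (valP q).
  have /andP[q1' q2'] := card_mixed _ (valP q').
  move: eqc => /(congr1 val); rewrite /= !inordK ?ltnS ?leq_subLR ?add2n //.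
  by move=> /(congr1 (addn 2)); rewrite !subnKC.
- have /andP[/existsP[i iq] /existsP[j jq]] := valP q.
  exists i, j => x Wx; split.
    by apply: phiU; exact: (Wx _ iq).1.
  by apply: psiV; exact: (Wx _ jq).1.
Qed.

(** * Fibrewise homotopies over an open subset *)

Section LocalHomotopy.
Context (R : realType) (B : topologicalType).
Local Notation I := (unit_itv R).

(** A homotopy over [U] as a function on all of [X * I] whose continuity is
required at the points over [U] only. Not having [U] in its domain makes
restriction, products and gluing immediate; the start and the fibre conditions
are imposed everywhere because extending by [f] outside [U] provides them. *)
Definition local_homotopy (X Y : fibSpace B) (f g : X -> Y) (U : set X)
    (h : X * I -> Y) : Prop :=
  [/\ forall x t, U x -> {for (x, t), continuous h},
      forall x, h (x, unit_itv0 R) = f x,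
      forall x, U x -> h (x, unit_itv1 R) = g x
    & forall x t, fib_proj (h (x, t)) = fib_proj x].

Definition homotopic_on (X Y : fibSpace B) (f g : X -> Y) (U : set X) : Prop :=
  exists h, local_homotopy f g U h.

Lemma homotopic_on_restr (X Y : fibSpace B) (f g : fibMap X Y) (U : set X) :
  homotopic_on f g U -> fib_homotopic R (fib_restr U f) (fib_restr U g).
Proof.
move=> [h [ch h0 h1 hp]].
exists (fun z : fib_sub U * I => h (set_val z.1, z.2)); split => //=.
- move=> [x t].
  apply: (@continuous_comp (fib_sub U * I)%type (X * I)%type Y
    (fun z => (set_val z.1, z.2)) h); last exact: (ch _ _ (set_valP x)).
  have c1 : {for (x, t), continuous (fun z : fib_sub U * I => set_val z.1)}.
    apply: (@continuous_comp _ _ _ (@fst (fib_sub U) I) set_val).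
      exact: cvg_fst.
    exact: initial_continuous.
  exact: (cvg_pair c1 (@cvg_snd _ _ _ _ _)).
- by move=> x; apply: h1; exact: set_valP.
Qed.

(** Openness of [U] makes the points over [U] interior, so that continuity on
the subspace is continuity of the extension at those points. *)
Lemma restr_homotopic_on (X Y : fibSpace B) (f g : fibMap X Y) (U : set X) :
  open U -> fib_homotopic R (fib_restr U f) (fib_restr U g) ->
  homotopic_on f g U.
Proof.
move=> oU [H [cH H0 H1 Hp]].
pose h (z : X * I) : Y :=
  if pselect (z.1 \in U) is left p then H (exist _ z.1 p, z.2) else f z.1.
have hE (x : fib_sub U) t : h (set_val x, t) = H (x, t).
  case: x => x p; rewrite /h /=; case: pselect => // p'.
  by congr (H (_, _)); exact: eq_sig_hprop.
exists h; split.
- move=> x t Ux N; have xU := mem_set Ux.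
  rewrite -[x]/(set_val (exist _ x xU : fib_sub U)) hE => /cH.
  case=> -[A C] [[/= _ [[S oS <-]] /= Sx SA] Ct] AC.
  exists (S `&` U, C) => /=.
    by split => //; apply: open_nbhs_nbhs; split; [exact: openI|split].
  move=> [y s] [/= [Sy Uy] Cs]; rewrite /nbhs /=.
  rewrite -[y]/(set_val (exist _ y (mem_set Uy) : fib_sub U)) /= hE.
  by apply: AC; split => //; exact: SA.
- by move=> x; rewrite /h /=; case: pselect => // p; rewrite H0.
- by move=> x /mem_set Ux; rewrite /h /=; case: pselect => // p; rewrite H1.
- move=> x t; rewrite /h /=; case: pselect => [p|_]; first by rewrite Hp.
  exact: fib_fun_proj.
Qed.

Lemma homotopic_on_sub (X Y : fibSpace B) (f g : X -> Y) (U V : set X) :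
  U `<=` V -> homotopic_on f g V -> homotopic_on f g U.
Proof.
move=> UV [h [ch h0 h1 hp]]; exists h; split => //.
  by move=> x t /UV; exact: ch.
by move=> x /UV; exact: h1.
Qed.

(** Near a point of [W q] the glued function is the homotopy chosen for [q],
since by disjointness no other index competes for the neighbouring points. *)
Lemma homotopic_on_bigcup (X Y : fibSpace B) (f g : fibMap X Y)
    (K : Type) (D : set K) (W : K -> set X) :
  (forall q, open (W q)) ->
  (forall q q' x, D q -> D q' -> W q x -> W q' x -> q = q') ->
  (forall q, D q -> homotopic_on f g (W q)) ->
  homotopic_on f g (\bigcup_(q in D) W q).
Proof.
move=> oW dW homW.
have /choice[k kP] : forall q, exists h : X * I -> Y,
    D q -> local_homotopy f g (W q) h.
  move=> q; have [Dq|nDq] := EM (D q).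
    by have [h hP] := homW q Dq; exists h.
  by exists (fun z => f z.1).
pose h (z : X * I) : Y :=
  if pselect (exists q, D q /\ W q z.1) is left p then k (projT1 (cid p)) z
  else f z.1.
have hE q x t : D q -> W q x -> h (x, t) = k q (x, t).
  move=> Dq Wqx; rewrite /h; case: pselect => [p|[]]; last by exists q.
  by case: cid => q' /= [Dq' Wq'x]; rewrite (dW _ _ _ Dq Dq' Wqx Wq'x).
exists h; split.
- move=> x t [q Dq Wqx]; have [ck _ _ _] := kP q Dq.
  rewrite /prop_for /continuous_at (hE q) //.
  apply: cvg_trans (ck x t Wqx); apply: near_eq_cvg.
  exists (W q, setT) => /=.
    by split; [apply: open_nbhs_nbhs; split|exact: filterT].
  by move=> [y s] [/= Wqy _]; rewrite (hE q).
- move=> x; rewrite /h; case: pselect => // p.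
  by case: cid => q /= [Dq _]; have [_ k0 _ _] := kP q Dq.
- move=> x [q Dq Wqx]; rewrite (hE q) //.
  by have [_ _ k1 _] := kP q Dq; exact: k1.
- move=> x t; rewrite /h; case: pselect => [p|_]; last exact: fib_fun_proj.
  by case: cid => q /= [Dq _]; have [_ _ _ kp] := kP q Dq.
Qed.

(** Both homotopies preserve fibres at every point, so the pair of them stays
in the fibrewise product even outside the two sets. *)
Lemma homotopic_on_prod (X Y X' Y' : fibSpace B)
    (f g : fibMap X Y) (f' g' : fibMap X' Y') (U : set X) (U' : set X') :
  homotopic_on f g U -> homotopic_on f' g' U' ->
  homotopic_on (fib_prod_map f f') (fib_prod_map g g')
    [set z : fib_prod X X' | U (set_val z).1 /\ U' (set_val z).2].
Proof.
move=> [h [ch h0 h1 hp]] [h' [ch' h0' h1' hp']].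
have mem_h (z : fib_prod X X') t :
    (h ((set_val z).1, t), h' ((set_val z).2, t)) \in @fib_prod_set B Y Y'.
  by apply/mem_set; rewrite /fib_prod_set /= hp hp'; exact: (set_valP z).
exists (fun z =>
  exist (fun u => u \in @fib_prod_set B Y Y') _ (mem_h z.1 z.2)); split.
- move=> z t [Uz U'z] N [/= _ [[S oS <-]] /= Sz SN].
  have cval : {for (z, t),
      continuous (fun w : fib_prod X X' * I => set_val w.1)}.
    apply: (@continuous_comp _ _ _ (@fst (fib_prod X X') I) set_val).
      exact: cvg_fst.
    exact: initial_continuous.
  have c1 : {for (z, t), continuous
      (fun w : fib_prod X X' * I => h ((set_val w.1).1, w.2))}.
    apply: (@continuous_comp (fib_prod X X' * I)%type (X * I)%type Y
      (fun w => ((set_val w.1).1, w.2)) h); last exact: ch.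
    have cval1 : {for (z, t),
        continuous (fun w : fib_prod X X' * I => (set_val w.1).1)}.
      by apply: continuous_comp; [exact: cval|exact: cvg_fst].
    exact: (cvg_pair cval1 (@cvg_snd _ _ _ _ _)).
  have c2 : {for (z, t), continuous
      (fun w : fib_prod X X' * I => h' ((set_val w.1).2, w.2))}.
    apply: (@continuous_comp (fib_prod X X' * I)%type (X' * I)%type Y'
      (fun w => ((set_val w.1).2, w.2)) h'); last exact: ch'.
    have cval2 : {for (z, t),
        continuous (fun w : fib_prod X X' * I => (set_val w.1).2)}.
      by apply: continuous_comp; [exact: cval|exact: cvg_snd].
    exact: (cvg_pair cval2 (@cvg_snd _ _ _ _ _)).
  have near_S : \forall w \near (z, t),
      S (h ((set_val w.1).1, w.2), h' ((set_val w.1).2, w.2)).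
    exact: (cvg_pair c1 c2 (open_nbhs_nbhs (conj oS Sz))).
  by apply: filterS near_S => w Sw; exact: SN.
- by move=> z; apply: val_inj; rewrite /= h0 h0'.
- by move=> z [Uz U'z]; apply: val_inj; rewrite /= h1 // h1'.
- by move=> z t; rewrite /= hp.
Qed.

End LocalHomotopy.

(** * Subadditivity of the distance *)

Lemma has_fib_cover_prod (R : realType) (B : topologicalType)
    (X Y X' Y' : fibSpace B) (f g : fibMap X Y) (f' g' : fibMap X' Y')
    (n m : nat) :
  normal_space (fib_prod X X') ->
  has_fib_cover R f g n -> has_fib_cover R f' g' m ->
  has_fib_cover R (fib_prod_map f f') (fib_prod_map g g') (n + m).
Proof.
move=> nN [U [oU covU homU]] [V [oV covV homV]].
pose pU i := [set z : fib_prod X X' | U i (set_val z).1].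
pose pV j := [set z : fib_prod X X' | V j (set_val z).2].
have cval : continuous (set_val : fib_prod X X' -> _).
  exact: initial_continuous.
have opU i : open (pU i).
  apply: (@open_comp _ _ (fun z : fib_prod X X' => (set_val z).1)) => // z _.
  by apply: continuous_comp; [exact: cval|exact: cvg_fst].
have opV j : open (pV j).
  apply: (@open_comp _ _ (fun z : fib_prod X X' => (set_val z).2)) => // z _.
  by apply: continuous_comp; [exact: cval|exact: cvg_snd].
have cpU z : exists i, pU i z.
  have : (\bigcup_i U i) (set_val z).1 by rewrite covU.
  by case=> i _ Ui; exists i.
have cpV z : exists j, pV j z.
  have : (\bigcup_j V j) (set_val z).2 by rewrite covV.
  by case=> j _ Vj; exists j.
have [K [c [W [oW covW dW WUV]]]] :=
  normal_common_refinement R nN opU cpU opV cpV.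
exists (fun k => \bigcup_(q in [set q | c q = k]) W q); split.
- by move=> k; apply: bigcup_open => q _; exact: oW.
- apply/seteqP; split => // z _; have [q Wq] := covW z.
  by exists (c q) => //; exists q.
- move=> k; apply: homotopic_on_restr; apply: homotopic_on_bigcup => //.
    by move=> q q' z <- /esym eqc; exact: dW.
  move=> q _; have [i [j WqUV]] := WUV q.
  apply: homotopic_on_sub WqUV _.
  by apply: homotopic_on_prod; apply: restr_homotopic_on.
Qed.

Lemma fib_dist_le (R : realType) (B : topologicalType)
    (X Y : fibSpace B) (f g : fibMap X Y) (n : nat) :
  has_fib_cover R f g n -> (fib_dist R f g <= n%:R%:E)%E.
Proof.
move=> covn; rewrite /fib_dist; case: pselect => [p|[]]; last by exists n.
by case: ex_minnP => k _ kmin; rewrite lee_fin ler_nat kmin //; apply/asboolP.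
Qed.

Variant fib_dist_spec (R : realType) (B : topologicalType)
    (X Y : fibSpace B) (f g : fibMap X Y) : \bar R -> Prop :=
  | FibDistFin n of has_fib_cover R f g n : fib_dist_spec f g n%:R%:E
  | FibDistInfty : fib_dist_spec f g +oo%E.

Lemma fib_distP (R : realType) (B : topologicalType)
    (X Y : fibSpace B) (f g : fibMap X Y) :
  fib_dist_spec f g (fib_dist R f g).
Proof.
rewrite /fib_dist; case: pselect => [p|_]; last exact: FibDistInfty.
by case: ex_minnP => k /asboolP covk _; exact: FibDistFin.
Qed.

Theorem proposition4p15 (R : realType) (B : topologicalType)
    (X Y X' Y' : fibSpace B) (f g : fibMap X Y) (f' g' : fibMap X' Y')
    (hN : normal_space (fib_prod X X')) :
  (fib_dist R (fib_prod_map f f') (fib_prod_map g g')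
     <= fib_dist R f g + fib_dist R f' g')%E.
Proof.
case: (fib_distP R f g) => [n covn|]; case: (fib_distP R f' g') => [m covm|].
- by rewrite -EFinD -natrD; apply: fib_dist_le; exact: has_fib_cover_prod.
- by rewrite addey ?leey.
- by rewrite addye ?leey.
- by rewrite addye ?leey.
Qed.
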